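(* Let $N=2$, let $F$ satisfy (A1), (A2) and (A4), and assume $F''(1)\ne3$. Let $E_{min}(q)=\inf\{\int_{\mathbb R^2}|\nabla\psi|^2dx+\int_{\mathbb R^2}|V(|\psi|^2)|dx:\psi\in\mathcal E,\ Q(\psi)=q\}$. Then $E_{min}(q)<v_sq$ for every $q>0$.
   Context: $F:[0,\infty)\to\mathbb R$, $V(s)=\int_s^1F$. (A1) $F$ continuous, $C^1$ near $1$, $F(1)=0$, $F'(1)=-1$ (paper's normalization). (A2) $|F(s)|\le C(1+s^{p_0})$ for some $C>0$, $p_0<\infty$. (A4) $F$ is $C^2$ near $1$ and $F(s)=-(s-1)+\frac12F''(1)(s-1)^2+O((s-1)^3)$ as $s\to1$. $v_s=\sqrt2$. Fix odd $\varphi\in C^\infty(\mathbb R)$, $\varphi(s)=s$ on $[0,2]$, $0\le\varphi'\le1$, $\varphi=3$ on $[4,\infty)$; $\mathcal E=\{\psi\in L^1_{loc}(\mathbb R^2;\mathbb C):\nabla\psi\in L^2,\varphi^2(|\psi|)-1\in L^2\}$. Momentum: $\mathcal Y=\{\partial_{x_1}\phi:\phi\in L^1_{loc},\nabla\phi\in L^2\}$, $L(v+w)=\int v$ ($v\in L^1$, $w\in\mathcal Y$), $Q(\psi)=L(\langle i\partial_{x_1}\psi,\psi\rangle)$, $\langle z_1,z_2\rangle=\mathrm{Re}(z_1\bar z_2)$. *)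

(* Defs.v *)
(* R^2 is modelled as R * R with the product of the
   Lebesgue measures; a complex-valued map psi = u + i w is modelled by the
   pair (u, w) of its real and imaginary parts. *)
From HB Require Import structures.
From mathcomp Require Import all_boot all_order all_algebra.
From mathcomp Require Import all_classical all_reals all_analysis.
Set Implicit Arguments. Unset Strict Implicit. Unset Printing Implicit Defensive.
Import Order.TTheory GRing.Theory Num.Theory.
Import numFieldNormedType.Exports.
Local Open Scope classical_set_scope.
Local Open Scope ring_scope.

Section Defs.
Variable R : realType.

Definition leb2 := ((@lebesgue_measure R) \x (@lebesgue_measure R))%E.

Definition partial1 (f : R * R -> R) : R * R -> R :=
  fun z => derive1 (fun t => f (t, z.2)) z.1.
Definition partial2 (f : R * R -> R) : R * R -> R :=
  fun z => derive1 (fun t => f (z.1, t)) z.2.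

Fixpoint iter_partial (ds : seq bool) (f : R * R -> R) : R * R -> R :=
  match ds with
  | [::] => f
  | d :: ds' => (if d then partial2 else partial1) (iter_partial ds' f)
  end.

Definition smooth2 (f : R * R -> R) : Prop :=
  forall ds : seq bool, continuous (iter_partial ds f) /\
    forall z : R * R,
      derivable (fun t => iter_partial ds f (t, z.2)) z.1 1 /\
      derivable (fun t => iter_partial ds f (z.1, t)) z.2 1.

Definition test_fun (chi : R * R -> R) : Prop :=
  smooth2 chi /\ compact (closure [set z | chi z != 0]).

Definition box (n : nat) : set (R * R) :=
  [set z | `|z.1| <= n%:R /\ `|z.2| <= n%:R].

Definition L1 (f : R * R -> R) : Prop := leb2.-integrable setT (EFin \o f).

Definition L1loc (f : R * R -> R) : Prop :=
  forall n : nat, leb2.-integrable (box n) (EFin \o f).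

Definition L2 (f : R * R -> R) : Prop :=
  measurable_fun setT f /\ (\int[leb2]_z ((f z) ^+ 2)%:E < +oo)%E.

Definition weak_grad (u g1 g2 : R * R -> R) : Prop :=
  L1loc u /\ L1loc g1 /\ L1loc g2 /\
  forall chi, test_fun chi ->
    (\int[leb2]_z (u z * partial1 chi z)%:E = - \int[leb2]_z (g1 z * chi z)%:E)%E /\
    (\int[leb2]_z (u z * partial2 chi z)%:E = - \int[leb2]_z (g2 z * chi z)%:E)%E.

Definition has_L2_grad (u g1 g2 : R * R -> R) : Prop :=
  weak_grad u g1 g2 /\ L2 g1 /\ L2 g2.

Definition cutoff (phi : R -> R) : Prop :=
  (forall s, phi (- s) = - phi s) /\
  (forall n x, derivable (derive1n n phi) x 1) /\
  (forall s, 0 <= s <= 2 -> phi s = s) /\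
  (forall s, 0 <= derive1 phi s <= 1) /\
  (forall s, 4 <= s -> phi s = 3).

Definition in_E (phi : R -> R) (u w gu1 gu2 gw1 gw2 : R * R -> R) : Prop :=
  has_L2_grad u gu1 gu2 /\ has_L2_grad w gw1 gw2 /\
  L2 (fun z => phi (Num.sqrt (u z ^+ 2 + w z ^+ 2)) ^+ 2 - 1).

(* Q(psi) = q : the density <i d_1 psi, psi> = Re(i d_1 psi * conj psi)
   = w d_1 u - u d_1 w  splits a.e. as v + d_1 chi with v in L^1 and chi in
   L^1_loc with L^2 gradient, and L(v + d_1 chi) = int v = q *)
Definition momentum_eq (u w gu1 gw1 : R * R -> R) (q : R) : Prop :=
  exists v chi h1 h2 : R * R -> R,
    L1 v /\ has_L2_grad chi h1 h2 /\
    {ae leb2, forall z, w z * gu1 z - u z * gw1 z = v z + h1 z} /\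
    (\int[leb2]_z (v z)%:E = q%:E)%E.

Definition Vpot (F : R -> R) (s : R) : R :=
  if s <= 1 then \int[@lebesgue_measure R]_(t in `[s, 1]) F t
  else - \int[@lebesgue_measure R]_(t in `[1, s]) F t.

Definition energy (F : R -> R) (u w gu1 gu2 gw1 gw2 : R * R -> R) : \bar R :=
  (\int[leb2]_z ((gu1 z ^+ 2 + gu2 z ^+ 2 + gw1 z ^+ 2 + gw2 z ^+ 2)%:E) +
   \int[leb2]_z (`|Vpot F (u z ^+ 2 + w z ^+ 2)|%:E))%E.

Definition Emin (F phi : R -> R) (q : R) : \bar R :=
  ereal_inf [set e | exists u w gu1 gu2 gw1 gw2 : R * R -> R,
    in_E phi u w gu1 gu2 gw1 gw2 /\ momentum_eq u w gu1 gw1 q /\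
    e = energy F u w gu1 gu2 gw1 gw2].

Definition hypA1 (F : R -> R) : Prop :=
  {within `[0, +oo[, continuous F} /\
  (exists2 d : R, 0 < d & forall s, `|s - 1| < d ->
      derivable F s 1 /\ {for s, continuous (derive1 F)}) /\
  F 1 = 0 /\ derive1 F 1 = -1.

Definition hypA2 (F : R -> R) : Prop :=
  exists C p0 : R, 0 < C /\ forall s, 0 <= s -> `|F s| <= C * (1 + s `^ p0).

Definition hypA4 (F : R -> R) : Prop :=
  (exists2 d : R, 0 < d & forall s, `|s - 1| < d ->
      derivable F s 1 /\ derivable (derive1 F) s 1 /\ {for s, continuous (derive1n 2 F)}) /\
  (exists C d : R, 0 < d /\ forall s, `|s - 1| < d ->
      `|F s - (- (s - 1) + 2^-1 * derive1n 2 F 1 * (s - 1) ^+ 2)| <= C * `|s - 1| ^+ 3).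

End Defs.

(* Main.v *)
Require Import Defs.
From HB Require Import structures.
From mathcomp Require Import all_boot all_order all_algebra.
From mathcomp Require Import all_classical all_reals all_analysis.
From mathcomp Require Import measurable_realfun ring lra.
Set Implicit Arguments. Unset Strict Implicit. Unset Printing Implicit Defensive.
Import Order.TTheory GRing.Theory Num.Theory.
Import numFieldNormedType.Exports.
Local Open Scope classical_set_scope.
Local Open Scope ring_scope.

(* Write psi = rho e^(i theta) and eta = rho^2 - 1. If theta has compact support,
   then Q(psi) = - int eta d_1 theta, and for eta = - sqrt 2 d_1 theta
     E(psi) - sqrt 2 Q(psi) = (3 - F''(1)) / 6 * int eta^3
       + int (|grad eta|^2 / (4 rho^2) + rho^2 (d_2 theta)^2) + O(int eta^4).
   Take theta(x) = s t f(t^2 x_1) g(k t^4 x_2) with f, g compactly supported,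
   s = 1 or -1, and int f'^3 and int g^3 nonzero. For every t the constraint
   Q(psi) = q holds for one and the same constant k. Relative to the area of the
   support the cubic term has order t^9, all other terms have order t^10, and s
   makes the cubic term negative; a small t therefore gives E(psi) < sqrt 2 q. *)

(** * Measurability and integrability on the plane *)

(** The relation between eta and theta is the equality case of eta^2 / 2 + (d_1 theta)^2 >= - sqrt 2
    eta d_1 theta, so the quadratic parts of E and sqrt 2 Q cancel exactly and only terms of higher
    order compete. The usual long-wave scaling (eta of size eps^2, lengths 1/eps and 1/eps^2) gives
    the cubic, gradient and transverse terms one common order, but its momentum tends to 0 with eps.
    A prescribed q calls for a more spread-out family. Let eta have size t^a and dilate the
    variables by t^b and t^c, so that theta has size t^(a-b). A constant integral of eta^2 forces b
    + c = 2 a. The cubic term then dominates (d_1 eta)^2 if 2 b > a, and (d_2 theta)^2, of order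
    t^(2(a-b+c)), if 4 b < 3 a. The exponents a = 3, b = 2, c = 4 satisfy all three conditions. *)

Section plane.
Context {R : realType}.
Implicit Types f g : R * R -> R.

(* The plane with the measurable structure that carries [leb2]; the canonical
   structure of [R * R] has another display, but the same measurable sets. *)
Local Notation RR := (measurableTypeR R * measurableTypeR R)%type.

(** Second countability: an open set is the union of the open boxes with rational endpoints that it
    contains, and there are countably many of them. *)
Lemma open_measurable_prod (A : set (R * R)) : open A -> measurable (A : set RR).
Proof.
move=> oA.
pose I := ((rat * rat) * (rat * rat))%type.
pose rect (i : I) : set (R * R) :=
  `]ratr i.1.1, ratr i.1.2[%classic `*` `]ratr i.2.1, ratr i.2.2[%classic.
have -> : A = \bigcup_(i : I) (if `[< rect i `<=` A >] then rect i else set0).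
  apply/seteqP; split => [[x y] Axy|z [i _]]; last first.
    by case: asboolP => // iA /iA.
  have := oA; rewrite openE => /(_ _ Axy) [] [U V] /= [Ux Vy] UVA.
  have sep (W : set R) (w : R) : nbhs w W -> exists a b : rat,
      [/\ ratr a < w, w < ratr b & `]ratr a, ratr b[ `<=` W].
    move=> /nbhs_ballP[e /= e0 eW].
    have [a] : exists q : rat, ratr q \in `]w - e, w[ by apply: rat_in_itvoo; lra.
    rewrite in_itv/= => /andP[a1 a2].
    have [b] : exists q : rat, ratr q \in `]w, w + e[ by apply: rat_in_itvoo; lra.
    rewrite in_itv/= => /andP[b1 b2].
    exists a, b; split => // r; rewrite /= in_itv/= => /andP[ar rb]; apply: eW.
    by rewrite /ball/= ltr_norml; apply/andP; split; lra.
  have [a [b [ax xb abU]]] := sep _ _ Ux.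
  have [c [d [cy yd cdV]]] := sep _ _ Vy.
  exists ((a, b), (c, d)) => //.
  case: asboolP => [_|]; first by split; rewrite /= in_itv/=; apply/andP.
  by case=> -[r s] [/abU Ur /cdV Vs]; exact: UVA.
apply: countable_bigcupT_measurable => [|i]; first exact: countableP.
case: ifP => // _.
by apply: measurableX; exact: measurable_itv.
Qed.

Lemma continuous_measurable_fun_prod f : continuous f -> measurable_fun setT f.
Proof.
move=> /continuousP cf.
apply: (measurability _ (RGenOpens.measurableE R)).
move=> _ [_ [a [b ->] <-]]; rewrite setTI; apply: open_measurable_prod.
exact/cf/interval_open.
Qed.

Definition rect (a b : R) : set (R * R) :=
  `[- a, a]%classic `*` `[- b, b]%classic.

Lemma measurable_rect a b : measurable (rect a b : set RR).
Proof. by apply: measurableX; exact: measurable_itv. Qed.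

Lemma leb2_rect a b : 0 < a -> 0 < b -> leb2 (rect a b) = (4 * a * b)%:E.
Proof.
move=> a0 b0; rewrite /leb2 product_measure1E; [|exact: measurable_itv..].
have muE (c : R) : 0 < c -> lebesgue_measure (`[- c, c]%classic : set R) = (2 * c)%:E.
  move=> c0; rewrite lebesgue_measure_itv/= lte_fin ifT; last lra.
  by rewrite -EFinD; congr EFin; lra.
by rewrite [X in (X * _)%E](muE a)// [X in (_ * X)%E](muE b)// -EFinM; congr EFin; lra.
Qed.

Lemma continuous_bounded_rect f a b : continuous f ->
  exists M, forall z, rect a b z -> `|f z| <= M.
Proof.
move=> cf; have : compact (f @` rect a b).
  apply: continuous_compact; first exact: continuous_subspaceT.
  by apply: compact_setX; exact: segment_compact.
move=> /compact_bounded[M [_ bM]]; exists (M + 1) => z az.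
by apply: (bM (M + 1)); [rewrite ltrDl|exists z].
Qed.

Lemma continuous_integrable_rect f a b : 0 < a -> 0 < b -> continuous f ->
  (@leb2 R).-integrable (rect a b) (EFin \o f).
Proof.
move=> a0 b0 cf; apply: measurable_bounded_integrable.
- exact: measurable_rect.
- by rewrite [X in (X < _)%E](leb2_rect a0 b0) ltry.
- apply: measurable_funS (continuous_measurable_fun_prod cf) => //.
- have [M bM] := continuous_bounded_rect a b cf.
  exists M; split; first exact: num_real.
  by move=> r Mr z az; apply: le_trans (bM z az) (ltW Mr).
Qed.

Lemma continuous_L1 f a b : 0 < a -> 0 < b -> continuous f ->
  (forall z, ~ rect a b z -> f z = 0) -> L1 f.
Proof.
move=> a0 b0 cf f0; rewrite /L1.
have := iffLR (integrable_mkcond _ (measurable_rect a b))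
  (continuous_integrable_rect a0 b0 cf).
congr (_.-integrable _ _); apply/funext => z; rewrite patchE.
by case: ifPn => //; rewrite notin_setE => /f0 /= ->.
Qed.

End plane.

(** * Weak gradients of C^1 functions *)

Section continuity.
Context {R : realType} {T : topologicalType}.
Implicit Types k l : T -> R.

Lemma continuous_add k l : continuous k -> continuous l ->
  continuous (fun z => k z + l z).
Proof. by move=> ck cl z; apply: cvgD; [exact: ck|exact: cl]. Qed.

Lemma continuous_sub k l : continuous k -> continuous l ->
  continuous (fun z => k z - l z).
Proof. by move=> ck cl z; apply: cvgB; [exact: ck|exact: cl]. Qed.

Lemma continuous_mul k l : continuous k -> continuous l ->
  continuous (fun z => k z * l z).
Proof. by move=> ck cl z; apply: cvgM; [exact: ck|exact: cl]. Qed.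

Lemma continuous_exp k n : continuous k -> continuous (fun z => k z ^+ n).
Proof.
move=> ck; elim: n => [|n IH]; first by move=> z; exact: cvg_cst.
by under eq_fun do rewrite exprS; exact: continuous_mul.
Qed.

Lemma continuous_constmul c k : continuous k -> continuous (fun z => c * k z).
Proof. by move=> ck; apply: continuous_mul => // z; exact: cvg_cst. Qed.

End continuity.

Section derivatives.
Context {R : realType}.
Implicit Types (k l : R -> R) (x dk dl c : R).

Lemma is_derive_mul k l x dk dl : is_derive x (1 : R) k dk ->
  is_derive x (1 : R) l dl ->
  is_derive x (1 : R) (fun t => k t * l t) (dk * l x + k x * dl).
Proof.
move=> hk hl; rewrite addrC [dk * _]mulrC; exact: (is_deriveM hk hl).
Qed.

Lemma is_derive_constmul c k x dk : is_derive x (1 : R) k dk ->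
  is_derive x (1 : R) (fun t => c * k t) (c * dk).
Proof. by move=> hk; exact: (is_deriveZ c hk). Qed.

Lemma is_derive_add k l x dk dl : is_derive x (1 : R) k dk ->
  is_derive x (1 : R) l dl -> is_derive x (1 : R) (fun t => k t + l t) (dk + dl).
Proof. by move=> hk hl; exact: (is_deriveD hk hl). Qed.

Lemma is_derive_chain k l x dk dl : is_derive (l x) (1 : R) k dk ->
  is_derive x (1 : R) l dl -> is_derive x (1 : R) (fun t => k (l t)) (dk * dl).
Proof. exact: is_derive1_comp. Qed.

Lemma is_derive_dilate k c x dk : is_derive (c * x) (1 : R) k dk ->
  is_derive x (1 : R) (fun t => k (c * t)) (c * dk).
Proof.
move=> hk; rewrite mulrC; apply: is_derive_chain => //.
by rewrite -[X in is_derive _ _ _ X]mulr1; apply: is_derive_constmul; exact: is_derive_id.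
Qed.

End derivatives.

Section weak_gradient.
Context {R : realType}.
Implicit Types f g : R * R -> R.
Local Notation mu := (@lebesgue_measure R).

Lemma continuous_pairl (y : R) : continuous (fun x : R => (x, y)).
Proof.
move=> x; apply: (@cvg_pair _ _ _ _ (nbhs x) (nbhs y) _ _ _ id (cst y)).
  exact: cvg_id.
exact: cvg_cst.
Qed.

Lemma continuous_pairr (x : R) : continuous (fun y : R => (x, y)).
Proof.
move=> y; apply: (@cvg_pair _ _ _ _ (nbhs x) (nbhs y) _ _ _ (cst x) id).
  exact: cvg_cst.
exact: cvg_id.
Qed.

Lemma integral_is_derive (H h : R -> R) (a b : R) : a < b -> continuous h ->
  (forall x : R, is_derive x (1 : R) H (h x)) ->
  (\int[mu]_(x in `[a, b]) (h x)%:E = (H b - H a)%:E)%E.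
Proof.
move=> ab ch dH; have cH x : {for x, continuous H}.
  apply/differentiable_continuous/derivable1_diffP.
  by case: (dH x).
rewrite (continuous_FTC2 (F := H))//; last 2 first.
- split; first by move=> x _; case: (dH x).
  + by apply: cvg_at_right_filter; exact: cH.
  + by apply: cvg_at_left_filter; exact: cH.
- by move=> x _; rewrite derive1E; exact: derive_val.
exact: continuous_subspaceT.
Qed.

Lemma integral_itv_support (h : R -> R) (a : R) :
  (forall x, ~~ (- a <= x <= a) -> h x = 0) ->
  (\int[mu]_x (h x)%:E = \int[mu]_(x in `[(- a)%R, a]) (h x)%:E)%E.
Proof.
move=> h0; rewrite [RHS]integral_mkcond; apply: eq_integral => x _.
rewrite patchE; case: ifPn => //; rewrite notin_setE/= in_itv/= => /negP xa.
by rewrite h0.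
Qed.

Lemma notin_rect (a b : R) z :
  ~ rect a b z <-> ~~ (- a <= z.1 <= a) \/ ~~ (- b <= z.2 <= b).
Proof.
rewrite /rect/= !in_itv/=; split.
  by move=> /not_andP[] /negP; [left|right].
by case=> /negP ? [].
Qed.

(** By Fubini it suffices to integrate along each horizontal line, where the fundamental theorem of
    calculus leaves two boundary values of [f] that vanish. *)
Lemma integral_derive1_eq0 f g (a b : R) : 0 < a -> 0 < b -> continuous g ->
  (forall z, ~ rect a b z -> f z = 0 /\ g z = 0) ->
  (forall z, is_derive z.1 (1 : R) (fun t => f (t, z.2)) (g z)) ->
  (\int[@leb2 R]_z (g z)%:E = 0)%E.
Proof.
move=> a0 b0 cg fg0 dfg.
have ig : L1 g by apply: (continuous_L1 a0 b0 cg) => z /fg0[].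
rewrite -(integral21_prod_meas1 ig); apply: integral0_eq => y _.
(* The interval reaches beyond [a] because [f] is known to vanish only off the closed rectangle. *)
rewrite /fubini_G/= (@integral_itv_support (fun x => g (x, y)) (a + 1)).
  have cgx : continuous (fun x => g (x, y)).
    move=> x; apply: (@continuous_comp _ _ _ (fun x => (x, y)) g); last exact: cg.
    exact: continuous_pairl.
  have dfx : forall x : R, is_derive x (1 : R) (fun t => f (t, y)) (g (x, y)).
    by move=> x; exact: (dfg (x, y)).
  rewrite (integral_is_derive _ cgx dfx); last lra.
  by rewrite !(proj1 (fg0 _ _)) ?subrr//; apply/notin_rect; left; rewrite /=; lra.
move=> x xa; apply: (proj2 (fg0 _ _)); apply/notin_rect; left => /=.
by apply: contraNN xa; lra.
Qed.

Lemma integral_derive2_eq0 f g (a b : R) : 0 < a -> 0 < b -> continuous g ->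
  (forall z, ~ rect a b z -> f z = 0 /\ g z = 0) ->
  (forall z, is_derive z.2 (1 : R) (fun t => f (z.1, t)) (g z)) ->
  (\int[@leb2 R]_z (g z)%:E = 0)%E.
Proof.
move=> a0 b0 cg fg0 dfg.
have ig : L1 g by apply: (continuous_L1 a0 b0 cg) => z /fg0[].
rewrite -(integral12_prod_meas1 ig); apply: integral0_eq => x _.
rewrite /fubini_F/= (@integral_itv_support (fun y => g (x, y)) (b + 1)).
  have cgy : continuous (fun y => g (x, y)).
    move=> y; apply: (@continuous_comp _ _ _ (fun y => (x, y)) g); last exact: cg.
    exact: continuous_pairr.
  have dfy : forall y : R, is_derive y (1 : R) (fun t => f (x, t)) (g (x, y)).
    by move=> y; exact: (dfg (x, y)).
  rewrite (integral_is_derive _ cgy dfy); last lra.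
  by rewrite !(proj1 (fg0 _ _)) ?subrr//; apply/notin_rect; right; rewrite /=; lra.
move=> y ya; apply: (proj2 (fg0 _ _)); apply/notin_rect; right => /=.
by apply: contraNN ya; lra.
Qed.

Lemma continuous_L1loc f : continuous f -> L1loc f.
Proof.
move=> cf n.
(* [box 0] is a single point, so a larger rectangle with positive sides is used. *)
have n1 : (0 : R) < n.+1%:R by rewrite ltr0n.
apply: integrableS (continuous_integrable_rect n1 n1 cf).
- exact: measurable_rect.
- have -> : box n = rect n%:R n%:R :> set (R * R).
    by apply/seteqP; split=> z; rewrite /box /rect/= !in_itv/= !ler_norml.
  exact: measurable_rect.
- move=> z; rewrite /box /rect/= !in_itv/= -!ler_norml => -[z1 z2].
  by split; [apply: le_trans z1 _|apply: le_trans z2 _]; rewrite ler_nat.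
Qed.

Lemma continuous_L2 f (a b : R) : 0 < a -> 0 < b -> continuous f ->
  (forall z, ~ rect a b z -> f z = 0) -> L2 f.
Proof.
move=> a0 b0 cf f0; split; first exact: continuous_measurable_fun_prod.
have cf2 : continuous (fun z => f z ^+ 2).
  exact: continuous_exp.
have : L1 (fun z => f z ^+ 2).
  by apply: (continuous_L1 a0 b0 cf2) => z /f0 ->; rewrite expr0n.
move=> /integrableP[_]; congr (_ < _)%E; apply: eq_integral => z _ /=.
by rewrite ger0_norm ?sqr_ge0.
Qed.

(** The partial derivatives vanish along with [chi] because a point off the closed support has a
    whole neighbourhood on which [chi] is zero. *)
Lemma test_fun_support (chi : R * R -> R) : test_fun chi ->
  exists2 n : R, 0 < n & forall z, ~ rect n n z ->
    [/\ chi z = 0, partial1 chi z = 0 & partial2 chi z = 0].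
Proof.
move=> [_ /[dup] Kc /compact_bounded[M [_ bM]]].
pose n := Num.max M 0 + 1.
have n0 : 0 < n by rewrite /n ltr_wpDl// le_max lexx orbT.
exists n => // z nz.
have cz : ~ closure [set z | chi z != 0] z.
  move=> /(bM n) => /(_ _)/wrap[].
    by rewrite /n ltr_pwDr// le_max lexx.
  rewrite /= prod_normE/= ge_max !ler_norml => /andP[z1 z2].
  by apply: nz; rewrite /rect/= !in_itv.
have near0 : \forall w \near z, chi w = 0.
  apply: contrapT => h; apply: cz => B Bz; apply: contrapT => /nonemptyPn AB.
  apply: h; apply: filterS Bz => w Bw; apply: contrapT => /eqP cw.
  by have : ([set z | chi z != 0] `&` B) w by []; rewrite AB.
split; first exact: nbhs_singleton near0.
- rewrite /partial1 derive1E; apply: derive_val.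
  apply: (@near_eq_is_derive _ _ _ (cst 0)).
  have near1 : \forall w \near (z.1, z.2), chi w = 0 by rewrite -surjective_pairing.
  have near2 : \forall t \near z.1, chi (t, z.2) = 0.
    exact: (@continuous_pairl z.2 z.1 _ near1).
  by apply: filterS near2 => t /= ->.
- rewrite /partial2 derive1E; apply: derive_val.
  apply: (@near_eq_is_derive _ _ _ (cst 0)).
  have near1 : \forall w \near (z.1, z.2), chi w = 0 by rewrite -surjective_pairing.
  have near2 : \forall t \near z.2, chi (z.1, t) = 0.
    exact: (@continuous_pairr z.1 z.2 _ near1).
  by apply: filterS near2 => t /= ->.
Qed.

(** Integration by parts: [f * chi] has compact support, so its partial derivatives have integral
    zero. No decay of [f] is assumed; the maps in polar form have modulus 1 at infinity. *)
Lemma C1_weak_grad f g1 g2 : continuous f -> continuous g1 -> continuous g2 ->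
  (forall z, is_derive z.1 (1 : R) (fun t => f (t, z.2)) (g1 z)) ->
  (forall z, is_derive z.2 (1 : R) (fun t => f (z.1, t)) (g2 z)) ->
  weak_grad f g1 g2.
Proof.
move=> cf c1 c2 d1 d2; do 3 (split; first exact: continuous_L1loc).
move=> chi tchi; have [n n0 supp] := test_fun_support tchi.
have [smooth _] := tchi.
have [/= cchi dchi] := smooth [::]; have [/= cchi1 _] := smooth [:: false].
have [/= cchi2 _] := smooth [:: true].
(* Moving one integral across the equation is legitimate in the extended reals because both are
   finite. *)
have conclude (k l : R * R -> R) : L1 k -> L1 l ->
    (\int[@leb2 R]_z (k z + l z)%:E = 0 ->
    \int[@leb2 R]_z (k z)%:E = - \int[@leb2 R]_z (l z)%:E)%E.
  move=> ik il; under eq_integral do rewrite EFinD.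
  rewrite (integralD measurableT ik il).
  rewrite -(fineK (integrable_fin_num _ ik))// -(fineK (integrable_fin_num _ il))//.
  by rewrite -EFinD -EFinN => -[] kl; congr EFin; lra.
split; apply: conclude.
- by apply: (continuous_L1 n0 n0 (continuous_mul cf cchi1)) => z /supp[_ -> _];
      rewrite mulr0.
- by apply: (continuous_L1 n0 n0 (continuous_mul c1 cchi)) => z /supp[-> _ _];
      rewrite mulr0.
- apply: (integral_derive1_eq0 (f := fun z => f z * chi z) n0 n0).
  + by apply: continuous_add; apply: continuous_mul.
  + by move=> z /supp[-> -> _];
      rewrite !mulr0 addr0.
  + move=> z; have := is_derive_mul (d1 z) (derivableP (dchi z).1).
    by rewrite -!surjective_pairing addrC -derive1E.
- by apply: (continuous_L1 n0 n0 (continuous_mul cf cchi2)) => z /supp[_ _ ->];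
      rewrite mulr0.
- by apply: (continuous_L1 n0 n0 (continuous_mul c2 cchi)) => z /supp[-> _ _];
      rewrite mulr0.
- apply: (integral_derive2_eq0 (f := fun z => f z * chi z) n0 n0).
  + by apply: continuous_add; apply: continuous_mul.
  + by move=> z /supp[-> _ ->];
      rewrite !mulr0 addr0.
  + move=> z; have := is_derive_mul (d2 z) (derivableP (dchi z).2).
    by rewrite -!surjective_pairing addrC -derive1E.
Qed.

End weak_gradient.

(** * Expansion of the potential *)

Section potential.
Context {R : realType}.
Local Notation mu := (@lebesgue_measure R).

Lemma Rintegral_approx (F H h : R -> R) (a b K : R) : a < b ->
  {within `[a, b], continuous F} -> continuous h ->
  (forall x : R, is_derive x (1 : R) H (h x)) ->
  (forall x, a <= x <= b -> `|F x - h x| <= K) ->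
  `|\int[mu]_(x in `[a, b]) F x - (H b - H a)| <= K * (b - a).
Proof.
move=> ab cF ch dH FhK.
have mI : measurable (`[a, b]%classic : set (measurableTypeR R)).
  exact: measurable_itv.
have iF : mu.-integrable `[a, b] (EFin \o F).
  by apply: continuous_compact_integrable => //; exact: segment_compact.
have ih : mu.-integrable `[a, b] (EFin \o h).
  apply: continuous_compact_integrable; first exact: segment_compact.
  exact: continuous_subspaceT.
have -> : H b - H a = \int[mu]_(x in `[a, b]) h x.
  by rewrite /Rintegral (integral_is_derive ab ch dH).
rewrite -RintegralB//; apply: le_trans.
  apply: le_normr_Rintegral => //.
  by have := integrableB mI iF ih.
have -> : K * (b - a) = \int[mu]_(x in `[a, b]) K.
  by rewrite Rintegral_cst//= lebesgue_measure_itv/= lte_fin ab.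
apply: le_Rintegral => //.
- have : mu.-integrable `[a, b] (EFin \o (F \- h)).
    by have := integrableB mI iF ih.
  exact: integrable_norm.
- apply: continuous_compact_integrable; first exact: segment_compact.
  by apply: continuous_subspaceT => x; exact: cvg_cst.
Qed.

(** The energy contains the absolute value of V. Near 1 the cubic Taylor polynomial of V equals e^2
    (3 - G e) / 6, which is nonnegative, so the absolute value costs nothing beyond the quartic
    error. *)
Lemma Vpot_expansion (F : R -> R) : hypA1 F -> hypA4 F ->
  exists C d : R, [/\ 0 <= C, 0 < d & forall e, `|e| < d ->
    `|Vpot F (1 + e)| <= 2^-1 * e ^+ 2 - derive1n 2 F 1 / 6 * e ^+ 3 + C * e ^+ 4].
Proof.
move=> [cF _] [_ [C [d [d0 hF]]]]; set G := derive1n 2 F 1 in hF *.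
pose C' := Num.max C 0.
have C'0 : 0 <= C' by rewrite /C' le_max lexx orbT.
have CC' : C <= C' by rewrite /C' le_max lexx.
(* [H] is the primitive, vanishing at 1, of the Taylor polynomial [h] of [F]; thus [- H]
   approximates V. *)
pose H t : R := - (2^-1 * (t - 1) ^+ 2) + G / 6 * (t - 1) ^+ 3.
pose h t : R := - (t - 1) + 2^-1 * G * (t - 1) ^+ 2.
have ch : continuous h.
  have c1 : continuous (fun t : R => t - 1).
    by apply: continuous_add => x; [exact: cvg_id|exact: cvg_cst].
  apply: continuous_add; last by apply: continuous_constmul; exact: continuous_exp.
  by move=> x; apply: cvgN; exact: c1.
have dH x : is_derive x (1 : R) H (h x).
  rewrite /H /h; apply: is_derive_eq.
  by rewrite /GRing.scale/=; field.
(* The bound 1 keeps the interval of integration in the half-line where [F] is continuous; the last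
   bound gives |G e| <= 3. *)
pose d' := Num.min (Num.min d 1) (3 / (1 + `|G|)).
have G0 : 0 < 1 + `|G| by rewrite ltr_pwDl.
exists C', d'; split => // [|e].
  by rewrite /d' !lt_min d0 ltr01 divr_gt0.
rewrite /d' !lt_min => /andP[/andP[ed e1] eG].
have {}eG : `|G * e| <= 3.
  rewrite normrM; move: eG; rewrite ltr_pdivlMr// => eG.
  have := normr_ge0 e; have := normr_ge0 G; nra.
have poly0 : 0 <= 2^-1 * e ^+ 2 - G / 6 * e ^+ 3.
  have -> : 2^-1 * e ^+ 2 - G / 6 * e ^+ 3 = e ^+ 2 / 6 * (3 - G * e) by field.
  apply: mulr_ge0; first by rewrite divr_ge0// sqr_ge0.
  by move: eG; rewrite ler_norml; lra.
suff : `|Vpot F (1 + e) - (2^-1 * e ^+ 2 - G / 6 * e ^+ 3)| <= C' * e ^+ 4.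
  move: poly0; set P := 2^-1 * _ - _; move: (Vpot _ _) (C' * _) => v c P0.
  by rewrite !ler_norml => /andP[h1 h2]; apply/andP; split; lra.
have He : H (1 + e) = - (2^-1 * e ^+ 2 - G / 6 * e ^+ 3).
  by rewrite /H (_ : 1 + e - 1 = e); ring.
have H1 : H 1 = 0 by rewrite /H subrr !expr0n/= !mulr0 addr0 oppr0.
have e4 : C' * e ^+ 4 = C' * `|e| ^+ 3 * `|e|.
  rewrite -mulrA -exprSr; congr (_ * _).
  by rewrite -normrX ger0_norm// exprn_even_ge0.
have hFh x : `|x - 1| <= `|e| -> `|F x - h x| <= C' * `|e| ^+ 3.
  move=> xe; apply: le_trans (hF x (le_lt_trans xe ed)) _.
  apply: le_trans (_ : C' * `|x - 1| ^+ 3 <= _).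
    by rewrite ler_wpM2r// exprn_ge0.
  by rewrite ler_wpM2l// lerXn2r// nnegrE.
have cFab a b : 0 <= a -> {within `[a, b], continuous F}.
  move=> a0; apply: continuous_subspaceW cF => x /=.
  rewrite !in_itv/= andbT => /andP[ax _]; exact: le_trans ax.
move: e1; rewrite ltr_norml => /andP[e1 e2].
rewrite /Vpot; have [e0|e0|->] := ltgtP e 0; last 1 first.
- rewrite addr0 lexx set_itv1 Rintegral_set1 !expr0n/= !mulr0 subrr subr0.
  by rewrite normr0.
- rewrite ifT; last lra.
  have := @Rintegral_approx F H h (1 + e) 1 (C' * `|e| ^+ 3) _ _ ch dH _.
  rewrite He H1 sub0r opprK e4.
  rewrite (_ : 1 - (1 + e) = `|e|); last by rewrite ltr0_norm//; lra.
  apply => //; first lra; first by apply: cFab; lra.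
  move=> x xe; apply: hFh; rewrite [`|e|]ltr0_norm// ler_norml; lra.
- rewrite ifF; last by apply/negbTE; rewrite -ltNge; lra.
  have := @Rintegral_approx F H h 1 (1 + e) (C' * `|e| ^+ 3) _ _ ch dH _.
  rewrite He H1 subr0 e4.
  rewrite (_ : 1 + e - 1 = `|e|); last by rewrite gtr0_norm//; lra.
  rewrite opprK -[X in X <= _]normrN opprD => main.
  apply: main => //; first lra; first by apply: cFab; lra.
  move=> x xe; apply: hFh; rewrite [`|e|]gtr0_norm// ler_norml; lra.
Qed.

End potential.

(** * One-dimensional profiles *)

Section profile.
Context {R : realType}.
Local Notation mu := (@lebesgue_measure R).
Implicit Types x y c : R.

Lemma continuous_pos : continuous (fun y : R => Num.max y 0).
Proof.
move=> y; apply: (continuous_max (f := id) (g := cst 0)); first exact: cvg_id.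
exact: cvg_cst.
Qed.

(** The exponent is at least 2 because of the kink at 0: there the difference quotient is the next
    lower power of the positive part, which is continuous and vanishes at 0. *)
Lemma is_derive_pos y n : is_derive y (1 : R) (fun y => Num.max y 0 ^+ n.+2)
  (n.+2%:R * Num.max y 0 ^+ n.+1).
Proof.
have [y0|y0|->] := ltgtP y 0.
- rewrite expr0n/= mulr0; apply: (@near_eq_is_derive _ _ _ (cst 0)).
  near=> z; rewrite max_r ?expr0n//.
  by apply/ltW; near: z; exact: lt_nbhsl.
- have dX : is_derive y (1 : R) (fun z => z ^+ n.+2) (n.+2%:R * y ^+ n.+1).
    rewrite -[X in is_derive _ _ _ X]mulr1.
    by have := is_deriveX n.+2 (is_derive_id y (1 : R)); rewrite exprfctE.
  apply: near_eq_is_derive dX; near=> z; rewrite max_l//.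
  by apply/ltW; near: z; exact: lt_nbhsr.
- apply/is_derive1_caratheodory.
  exists (fun z => Num.max z 0 ^+ n.+1); split.
  + move=> z; rewrite maxxx expr0n !subr0 exprSr.
    by have [z0|z0] := leP z 0; rewrite ?mulr0// expr0n/= mul0r.
  + by apply: (continuous_exp continuous_pos).
  + by rewrite maxxx expr0n/= mulr0.
Unshelve. all: by end_near. Qed.

(* [prof] and [prof2] are the functions f and g above. [prof] is odd: for an even f
   the integral of f'^3 would vanish. *)
Definition bump x : R := Num.max (1 - x ^+ 2) 0.
Definition prof x : R := x * bump x ^+ 3.
Definition prof' x : R := bump x ^+ 3 - 6 * x ^+ 2 * bump x ^+ 2.
Definition prof'' x : R := 24 * x ^+ 3 * bump x - 18 * x * bump x ^+ 2.
Definition prof2 x : R := bump x ^+ 2.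
Definition prof2' x : R := - 4 * x * bump x.

Lemma bump_out x : ~~ (- 1 <= x <= 1) -> bump x = 0.
Proof. by move=> x1; rewrite /bump max_r//; nra. Qed.

Lemma bump_in x : - 1 <= x <= 1 -> bump x = 1 - x ^+ 2.
Proof. by move=> x1; rewrite /bump max_l//; nra. Qed.

Lemma continuous_bump : continuous bump.
Proof.
move=> x; apply: (@continuous_comp _ _ _ (fun x : R => 1 - x ^+ 2) (fun y : R => Num.max y 0)).
  apply: cvgB; first exact: cvg_cst.
  exact: exprn_continuous.
exact: continuous_pos.
Qed.

Lemma is_derive_bump n x : is_derive x (1 : R) (fun x => bump x ^+ n.+2)
  (- (2 * n.+2%:R) * x * bump x ^+ n.+1).
Proof.
rewrite (_ : - (2 * _) * _ * _ = n.+2%:R * bump x ^+ n.+1 * (- (2 * x))); last by ring.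
apply: (@is_derive_chain _ (fun y => Num.max y 0 ^+ n.+2) (fun x => 1 - x ^+ 2)).
  exact: is_derive_pos.
by apply: is_derive_eq; rewrite /GRing.scale/=; ring.
Qed.

Lemma is_derive_prof x : is_derive x (1 : R) prof (prof' x).
Proof.
rewrite (_ : prof' x = 1 * bump x ^+ 3 + x * (- (2 * 3) * x * bump x ^+ 2));
  last by rewrite /prof'; ring.
exact: (is_derive_mul (is_derive_id x 1) (is_derive_bump 1 x)).
Qed.

(** This second derivative is the reason for the cube in [prof]: eta is a multiple of d_1 theta and
    is itself differentiated in the energy. In x_2 one continuous derivative suffices, hence the
    square in [prof2]. *)
Lemma is_derive_prof' x : is_derive x (1 : R) prof' (prof'' x).
Proof.
have d2 : is_derive x (1 : R) (fun x => - 6 * x ^+ 2) (- 12 * x).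
  by apply: is_derive_eq; rewrite /GRing.scale/=; ring.
have := is_derive_add (is_derive_bump 1 x) (is_derive_mul d2 (is_derive_bump 0 x)).
rewrite (_ : prof' = fun t => bump t ^+ 3 + - 6 * t ^+ 2 * bump t ^+ 2).
  by congr is_derive; rewrite /prof''; ring.
by apply/funext => t; rewrite /prof'; ring.
Qed.

Lemma is_derive_prof2 x : is_derive x (1 : R) prof2 (prof2' x).
Proof.
rewrite (_ : prof2' x = - (2 * 2) * x * bump x ^+ 1); last by rewrite /prof2'; ring.
exact: is_derive_bump.
Qed.

Lemma prof_out x : ~~ (- 1 <= x <= 1) ->
  [/\ prof x = 0, prof' x = 0, prof'' x = 0, prof2 x = 0 & prof2' x = 0].
Proof.
move=> /bump_out b0; rewrite /prof /prof' /prof'' /prof2 /prof2' b0.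
by split; ring.
Qed.

(** On [-1, 1] every monomial in [x] and [bump x] is at most 1 in absolute value, so sums of
    coefficients are bounds; the largest is 24 + 18 = 42, for [prof'']. *)
Lemma prof_bound x :
  [/\ `|prof x| <= 50, `|prof' x| <= 50, `|prof'' x| <= 50, `|prof2 x| <= 50
    & `|prof2' x| <= 50].
Proof.
have [x1|/prof_out[-> -> -> -> ->]] := boolP (- 1 <= x <= 1); last first.
  by rewrite normr0 ler0n.
have b1 : `|bump x| <= 1 by rewrite bump_in// ler_norml; nra.
have {}x1 : `|x| <= 1 by rewrite ler_norml.
have bn n : `|bump x ^+ n| <= 1 by rewrite normrX exprn_ile1.
have xn n : `|x ^+ n| <= 1 by rewrite normrX exprn_ile1.
have M1 (a b : R) : `|a| <= 1 -> `|b| <= 1 -> `|a * b| <= 1.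
  by move=> ha hb; rewrite normrM mulr_ile1.
have x32 := M1 _ _ x1 (bn 3); have h1 := M1 _ _ (xn 2) (bn 2).
have h2 := M1 _ _ (xn 3) b1; have h3 := M1 _ _ x1 (bn 2).
have h4 := M1 _ _ x1 b1; have := bn 3; have := bn 2.
move: x32 h1 h2 h3 h4; rewrite /prof /prof' /prof'' /prof2 /prof2' !ler_norml.
by move=> /andP[? ?] /andP[? ?] /andP[? ?] /andP[? ?] /andP[? ?] /andP[? ?] /andP[? ?];
  split; apply/andP; split; lra.
Qed.

Lemma continuous_prof : [/\ continuous prof, continuous prof', continuous prof'',
  continuous prof2 & continuous prof2'].
Proof.
have cb := continuous_bump; have cid : continuous (@id R) by move=> x; exact: cvg_id.
have cx n : continuous (fun x : R => x ^+ n) := continuous_exp cid.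
have cbn n : continuous (fun x => bump x ^+ n) := continuous_exp cb.
split.
- exact: continuous_mul.
- move=> x; apply: cvgB; first exact: cbn.
  by apply: (continuous_mul (k := fun x => 6 * x ^+ 2)) => //; exact: continuous_constmul.
- move=> x; apply: cvgB.
    by apply: (continuous_mul (k := fun x => 24 * x ^+ 3)) => //; exact: continuous_constmul.
  by apply: (continuous_mul (k := fun x => 18 * x)) => //; exact: continuous_constmul.
- exact: cbn.
- by apply: (continuous_mul (k := fun x => - 4 * x)) => //; exact: continuous_constmul.
Qed.

(** Change of variables through the primitive H(c x) / c. The profiles are polynomial only on
    [-1, 1], so a global polynomial [h] takes the place of [k] there. *)
Lemma integral_dilate (k h H : R -> R) c : 0 < c -> continuous h ->
  (forall x : R, is_derive x (1 : R) H (h x)) ->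
  (forall x, - 1 <= x <= 1 -> k x = h x) ->
  (forall x, ~~ (- 1 <= x <= 1) -> k x = 0) ->
  (\int[mu]_x (k (c * x))%:E = ((H 1 - H (- 1)) / c)%:E)%E.
Proof.
move=> c0 ch dH kh k0.
have cx1 x : (- c^-1 <= x <= c^-1) = (- 1 <= c * x <= 1).
  by rewrite -!ler_norml normrM (gtr0_norm c0) mulrC -ler_pdivlMr// div1r.
rewrite (@integral_itv_support _ (fun x => k (c * x)) c^-1); last first.
  by move=> x; rewrite cx1 => /k0.
transitivity (\int[mu]_(x in `[(- c^-1)%R, c^-1%R]) (h (c * x))%:E)%E.
  by apply: eq_integral => x; rewrite inE/= in_itv/= cx1 => /kh ->.
have dHc x : is_derive x (1 : R) (fun x => c^-1 * H (c * x)) (h (c * x)).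
  rewrite -[h _](mulKf (lt0r_neq0 c0)).
  by apply: is_derive_constmul; exact: is_derive_dilate.
have chc : continuous (fun x => h (c * x)).
  move=> x; apply: (@continuous_comp _ _ _ (fun x => c * x) h); last exact: ch.
  exact: mulrl_continuous.
rewrite (integral_is_derive _ chc dHc).
  by congr EFin; rewrite mulrN divff ?lt0r_neq0//; ring.
by rewrite gtrN// invr_gt0.
Qed.

(** [pol] and [pol2] are [prof'] and [prof2] without the truncation at 0; their powers have explicit
    polynomial primitives. *)
Let pol x : R := (1 - x ^+ 2) ^+ 3 - 6 * x ^+ 2 * (1 - x ^+ 2) ^+ 2.

Let pol2 x : R := (1 - x ^+ 2) ^+ 2.

Let continuous_pol2 : continuous pol2.
Proof.
apply: continuous_exp => x; apply: cvgB; first exact: cvg_cst.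
exact: exprn_continuous.
Qed.

Let continuous_pol : continuous pol.
Proof.
have cb : continuous (fun x : R => 1 - x ^+ 2).
  by move=> x; apply: cvgB; [exact: cvg_cst|exact: exprn_continuous].
apply: continuous_sub; first exact: continuous_exp.
apply: continuous_mul; last exact: continuous_exp.
by apply: continuous_constmul; exact: exprn_continuous.
Qed.

Lemma integral_prof'_sqr : exists2 A : R, 0 < A & forall c, 0 < c ->
  (\int[mu]_x (prof' (c * x) ^+ 2)%:E = (A / c)%:E)%E.
Proof.
(* The value is H(1) - H(-1) for the primitive [H] of [pol ^+ 2] below; the next three lemmas obtain
   theirs in the same way. *)
exists (3072 / 5005); first by rewrite divr_gt0 ?mulr_gt0 ?ltr0n.
move=> c c0.
pose H x : R := x - 6 * x ^+ 3 + 111 / 5 * x ^+ 5 - 284 / 7 * x ^+ 7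
  + 39 * x ^+ 9 - 210 / 11 * x ^+ 11 + 49 / 13 * x ^+ 13.
have dH x : is_derive x (1 : R) H (pol x ^+ 2).
  by rewrite /H /pol; apply: is_derive_eq; rewrite /GRing.scale/=; field.
rewrite (@integral_dilate (fun x => prof' x ^+ 2) _ H _ c0
  (continuous_exp (n := 2) continuous_pol) dH).
- by congr EFin; congr (_ / _); rewrite /H; field.
- by move=> x x1; rewrite /pol /prof' bump_in.
- by move=> x /prof_out[_ -> _ _ _]; rewrite expr0n.
Qed.

(** On [-1, 1], [prof'] is (1 - x^2)^2 (1 - 7 x^2), with integral zero, a central peak of height 1
    and negative lobes of depth 32/49. Cubing favours the peak, whence a positive value. *)
Lemma integral_prof'_cube : exists2 A : R, 0 < A & forall c, 0 < c ->
  (\int[mu]_x (prof' (c * x) ^+ 3)%:E = (A / c)%:E)%E.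
Proof.
exists ((512 * 576) / (5005 * 323)); first by rewrite divr_gt0 ?mulr_gt0 ?ltr0n.
move=> c c0.
pose H x : R := x - 9 * x ^+ 3 + 288 / 5 * x ^+ 5 - 1560 / 7 * x ^+ 7
  + 522 * x ^+ 9 - 8406 / 11 * x ^+ 11 + 9192 / 13 * x ^+ 13
  - 2016 / 5 * x ^+ 15 + 2205 / 17 * x ^+ 17 - 343 / 19 * x ^+ 19.
have dH x : is_derive x (1 : R) H (pol x ^+ 3).
  by rewrite /H /pol; apply: is_derive_eq; rewrite /GRing.scale/=; field.
rewrite (@integral_dilate (fun x => prof' x ^+ 3) _ H _ c0
  (continuous_exp (n := 3) continuous_pol) dH).
- by congr EFin; congr (_ / _); rewrite /H; field.
- by move=> x x1; rewrite /pol /prof' bump_in.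
- by move=> x /prof_out[_ -> _ _ _]; rewrite expr0n.
Qed.

Lemma integral_prof2_sqr : exists2 A : R, 0 < A & forall c, 0 < c ->
  (\int[mu]_x (prof2 (c * x) ^+ 2)%:E = (A / c)%:E)%E.
Proof.
exists (256 / 315); first by rewrite divr_gt0 ?mulr_gt0 ?ltr0n.
move=> c c0.
pose H x : R := x - 4 / 3 * x ^+ 3 + 6 / 5 * x ^+ 5 - 4 / 7 * x ^+ 7
  + 9^-1 * x ^+ 9.
have dH x : is_derive x (1 : R) H (pol2 x ^+ 2).
  by rewrite /H /pol2; apply: is_derive_eq; rewrite /GRing.scale/=; field.
rewrite (@integral_dilate (fun x => prof2 x ^+ 2) _ H _ c0
  (continuous_exp (n := 2) continuous_pol2) dH).
- by congr EFin; congr (_ / _); rewrite /H; field.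
- by move=> x x1; rewrite /pol2 /prof2 bump_in.
- by move=> x /prof_out[_ _ _ -> _]; rewrite expr0n.
Qed.

Lemma integral_prof2_cube : exists2 A : R, 0 < A & forall c, 0 < c ->
  (\int[mu]_x (prof2 (c * x) ^+ 3)%:E = (A / c)%:E)%E.
Proof.
exists (2048 / 3003); first by rewrite divr_gt0 ?mulr_gt0 ?ltr0n.
move=> c c0.
pose H x : R := x - 2 * x ^+ 3 + 3 * x ^+ 5 - 20 / 7 * x ^+ 7
  + 5 / 3 * x ^+ 9 - 6 / 11 * x ^+ 11 + 13^-1 * x ^+ 13.
have dH x : is_derive x (1 : R) H (pol2 x ^+ 3).
  by rewrite /H /pol2; apply: is_derive_eq; rewrite /GRing.scale/=; field.
rewrite (@integral_dilate (fun x => prof2 x ^+ 3) _ H _ c0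
  (continuous_exp (n := 3) continuous_pol2) dH).
- by congr EFin; congr (_ / _); rewrite /H; field.
- by move=> x x1; rewrite /pol2 /prof2 bump_in.
- by move=> x /prof_out[_ _ _ -> _]; rewrite expr0n.
Qed.

End profile.

(** * Integrals of products of functions of one variable *)

Section product.
Context {R : realType}.
Local Notation mu := (@lebesgue_measure R).

Lemma integrable_itv_support (a : R -> R) (c : R) : continuous a ->
  (forall x, ~~ (- c <= x <= c) -> a x = 0) ->
  mu.-integrable setT (EFin \o a).
Proof.
move=> ca a0.
have mI : measurable (`[- c, c]%classic : set (measurableTypeR R)).
  exact: measurable_itv.
have : mu.-integrable `[- c, c] (EFin \o a).
  apply: continuous_compact_integrable; first exact: segment_compact.
  exact: continuous_subspaceT.
move=> /(iffLR (integrable_mkcond _ mI)).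
congr (_.-integrable _ _); apply/funext => x; rewrite patchE.
case: ifPn => //; rewrite notin_setE/= in_itv/= => /negP xc.
by rewrite /= a0.
Qed.

Lemma continuous_fstsnd (a b : R -> R) : continuous a -> continuous b ->
  continuous (fun z : R * R => a z.1 * b z.2).
Proof.
move=> ca cb; apply: continuous_mul => z.
  by apply: (@continuous_comp _ _ _ fst a); [exact: cvg_fst|exact: ca].
by apply: (@continuous_comp _ _ _ snd b); [exact: cvg_snd|exact: cb].
Qed.

Lemma integral_fstsnd (a b : R -> R) (A B c d : R) : 0 < c -> 0 < d ->
  continuous a -> continuous b ->
  (forall x, ~~ (- c <= x <= c) -> a x = 0) ->
  (forall x, ~~ (- d <= x <= d) -> b x = 0) ->
  (\int[mu]_x (a x)%:E = A%:E -> \int[mu]_x (b x)%:E = B%:E ->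
   \int[@leb2 R]_z (a z.1 * b z.2)%:E = (A * B)%:E)%E.
Proof.
move=> c0 d0 ca cb a0 b0 IA IB.
have iab : L1 (fun z : R * R => a z.1 * b z.2).
  apply: (continuous_L1 c0 d0 (continuous_fstsnd ca cb)) => z /notin_rect[/a0|/b0] ->.
    by rewrite mul0r.
  by rewrite mulr0.
rewrite -(integral12_prod_meas1 iab).
have ia := integrable_itv_support ca a0; have ib := integrable_itv_support cb b0.
transitivity (\int[mu]_x ((a x)%:E * B%:E))%E.
  apply: eq_integral => x _; rewrite /fubini_F/= -IB.
  under eq_integral do rewrite EFinM.
  by rewrite (integralZl measurableT ib).
by rewrite (integralZr measurableT ia) IA -EFinM.
Qed.

End product.

(** * Maps in polar form *)

Section polar_derivative.
Context {R : realType}.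
Implicit Types (e th : R -> R) (x de dth : R).

Lemma is_derive_sqrt1 e x de : 0 < 1 + e x -> is_derive x (1 : R) e de ->
  is_derive x (1 : R) (fun y => Num.sqrt (1 + e y)) (de / (2 * Num.sqrt (1 + e x))).
Proof.
move=> e0 he; rewrite mulrC.
apply: (@is_derive_chain _ Num.sqrt (fun y => 1 + e y)).
  exact: is_derive1_sqrt.
by rewrite -[de]add0r; apply: is_derive_add => //; exact: is_derive_cst.
Qed.

Lemma is_derive_polar_cos e th x de dth : 0 < 1 + e x ->
  is_derive x (1 : R) e de -> is_derive x (1 : R) th dth ->
  is_derive x (1 : R) (fun y => Num.sqrt (1 + e y) * cos (th y))
    (de / (2 * Num.sqrt (1 + e x)) * cos (th x)
     + Num.sqrt (1 + e x) * (- sin (th x) * dth)).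
Proof.
move=> e0 he hth; apply: is_derive_mul; exact: is_derive_sqrt1.
Qed.

Lemma is_derive_polar_sin e th x de dth : 0 < 1 + e x ->
  is_derive x (1 : R) e de -> is_derive x (1 : R) th dth ->
  is_derive x (1 : R) (fun y => Num.sqrt (1 + e y) * sin (th y))
    (de / (2 * Num.sqrt (1 + e x)) * sin (th x)
     + Num.sqrt (1 + e x) * (cos (th x) * dth)).
Proof.
move=> e0 he hth; apply: is_derive_mul; exact: is_derive_sqrt1.
Qed.

End polar_derivative.

Section integral_bounds.
Context {R : realType}.
Import HBNNSimple.

(* Unlike [ge0_le_integral], this needs no measurability, so [Vpot F] can be
   integrated without a proof that it is measurable. *)
Lemma ge0_le_integralT d (T : measurableType d) (mu : {measure set T -> \bar R})
    (f g : T -> \bar R) : (forall x, 0 <= f x)%E -> (forall x, f x <= g x)%E ->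
  (\int[mu]_x f x <= \int[mu]_x g x)%E.
Proof.
move=> f0 fg; rewrite !ge0_integralTE//; last by move=> x; apply: le_trans (fg x).
apply: ereal_sup_le => _ [h hf <-]; exists h => // x.
by apply: le_trans (fg x); exact: hf.
Qed.

Lemma integral_le_rect (f : R * R -> R) (K a b : R) : 0 < a -> 0 < b ->
  continuous f -> (forall z, ~ rect a b z -> f z = 0) -> (forall z, f z <= K) ->
  (\int[@leb2 R]_z (f z)%:E <= (K * (4 * a * b))%:E)%E.
Proof.
move=> a0 b0 cf f0 fK.
have -> : (\int[@leb2 R]_z (f z)%:E = \int[@leb2 R]_(z in rect a b) (f z)%:E)%E.
  rewrite [RHS]integral_mkcond; apply: eq_integral => z _.
  by rewrite patchE; case: ifPn => //; rewrite notin_setE => /f0 ->.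
have -> : ((K * (4 * a * b))%:E = \int[@leb2 R]_(z in rect a b) K%:E)%E.
  rewrite integral_cst; last exact: measurable_rect.
  by rewrite [X in (_ * X)%E](leb2_rect a0 b0) -EFinM.
apply: le_integral.
- exact: measurable_rect.
- exact: continuous_integrable_rect.
- by apply: (continuous_integrable_rect (f := cst K)) => // z; exact: cvg_cst.
- by move=> z _; rewrite lee_fin.
Qed.

End integral_bounds.

Section polar.
Context {R : realType}.

Definition polar_mod (eta : R * R -> R) z := Num.sqrt (1 + eta z).

Definition polar_re (eta th : R * R -> R) z := polar_mod eta z * cos (th z).

Definition polar_im (eta th : R * R -> R) z := polar_mod eta z * sin (th z).

(** The derivative of [polar_re] in a direction in which [eta] and [th] have derivatives [e] and
    [t]; one formula serves both partial derivatives. *)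
Definition dpolar_re (eta th e t : R * R -> R) z :=
  e z / (2 * polar_mod eta z) * cos (th z) + polar_mod eta z * (- sin (th z) * t z).

Definition dpolar_im (eta th e t : R * R -> R) z :=
  e z / (2 * polar_mod eta z) * sin (th z) + polar_mod eta z * (cos (th z) * t z).

Variables (eta e1 e2 th t1 t2 : R * R -> R) (a b : R).
Hypotheses (a0 : 0 < a) (b0 : 0 < b).
Hypotheses (ceta : continuous eta) (ce1 : continuous e1) (ce2 : continuous e2).
Hypotheses (cth : continuous th) (ct1 : continuous t1) (ct2 : continuous t2).
Hypothesis de1 : forall z, is_derive z.1 (1 : R) (fun t => eta (t, z.2)) (e1 z).
Hypothesis de2 : forall z, is_derive z.2 (1 : R) (fun t => eta (z.1, t)) (e2 z).
Hypothesis dt1 : forall z, is_derive z.1 (1 : R) (fun t => th (t, z.2)) (t1 z).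
Hypothesis dt2 : forall z, is_derive z.2 (1 : R) (fun t => th (z.1, t)) (t2 z).
Hypothesis supp : forall z, ~ rect a b z ->
  [/\ eta z = 0, e1 z = 0, e2 z = 0, t1 z = 0 & t2 z = 0].
Hypothesis eta_small : forall z, `|eta z| <= 2^-1.

Local Notation rho := (polar_mod eta).
Local Notation u := (polar_re eta th).
Local Notation w := (polar_im eta th).
Local Notation gu := (dpolar_re eta th).
Local Notation gw := (dpolar_im eta th).

Let eta1_gt0 z : 0 < 1 + eta z.
Proof. by have := eta_small z; rewrite ler_norml; lra. Qed.

Let rho_gt0 z : 0 < rho z. Proof. by rewrite sqrtr_gt0. Qed.

Let rho2 z : rho z ^+ 2 = 1 + eta z. Proof. by rewrite sqr_sqrtr// ltW. Qed.

Let modulus z : u z ^+ 2 + w z ^+ 2 = 1 + eta z.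
Proof. by rewrite -rho2 /polar_re /polar_im !exprMn -mulrDr cos2Dsin2 mulr1. Qed.

Let c_rho : continuous rho.
Proof.
move=> z; apply: (@continuous_comp _ _ _ (fun z => 1 + eta z) Num.sqrt).
  by apply: (@continuous_add _ _ (cst 1)) => // y; exact: cvg_cst.
exact: sqrt_continuous.
Qed.

Let c_cos : continuous (fun z => cos (th z)).
Proof.
move=> z; apply: (@continuous_comp _ _ _ th cos); first exact: cth.
exact: continuous_cos.
Qed.

Let c_sin : continuous (fun z => sin (th z)).
Proof.
move=> z; apply: (@continuous_comp _ _ _ th sin); first exact: cth.
exact: continuous_sin.
Qed.

Let c_half (e : R * R -> R) : continuous e -> continuous (fun z => e z / (2 * rho z)).
Proof.
move=> ce; apply: continuous_mul => // z; apply: cvgV.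
  by rewrite mulf_neq0 ?pnatr_eq0// lt0r_neq0.
exact: continuous_constmul.
Qed.

Let c_gu e t : continuous e -> continuous t -> continuous (gu e t).
Proof.
move=> ce ct; apply: continuous_add; apply: continuous_mul => //.
  exact: c_half.
by apply: continuous_mul => // z; apply: cvgN; exact: c_sin.
Qed.

Let c_gw e t : continuous e -> continuous t -> continuous (gw e t).
Proof.
move=> ce ct; apply: continuous_add; apply: continuous_mul => //.
  exact: c_half.
exact: continuous_mul.
Qed.

Let c_u : continuous u. Proof. exact: continuous_mul. Qed.
Let c_w : continuous w. Proof. exact: continuous_mul. Qed.

Lemma polar_in_E (phi : R -> R) : cutoff phi ->
  in_E phi u w (gu e1 t1) (gu e2 t2) (gw e1 t1) (gw e2 t2).
Proof.
move=> [_ [_ [phi_id _]]]; split; [|split].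
- split; [|split].
  + apply: C1_weak_grad => //; [exact: c_gu|exact: c_gu|..] => -[x y].
    * exact: (@is_derive_polar_cos _ (fun t => eta (t, y)) (fun t => th (t, y)) x _ _
        (eta1_gt0 (x, y)) (de1 (x, y)) (dt1 (x, y))).
    * exact: (@is_derive_polar_cos _ (fun t => eta (x, t)) (fun t => th (x, t)) y _ _
        (eta1_gt0 (x, y)) (de2 (x, y)) (dt2 (x, y))).
  + by apply: (continuous_L2 a0 b0 (c_gu ce1 ct1)) => z /supp[_ h _ h' _];
      rewrite /dpolar_re h h'; ring.
  + by apply: (continuous_L2 a0 b0 (c_gu ce2 ct2)) => z /supp[_ _ h _ h'];
      rewrite /dpolar_re h h'; ring.
- split; [|split].
  + apply: C1_weak_grad => //; [exact: c_gw|exact: c_gw|..] => -[x y].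
    * exact: (@is_derive_polar_sin _ (fun t => eta (t, y)) (fun t => th (t, y)) x _ _
        (eta1_gt0 (x, y)) (de1 (x, y)) (dt1 (x, y))).
    * exact: (@is_derive_polar_sin _ (fun t => eta (x, t)) (fun t => th (x, t)) y _ _
        (eta1_gt0 (x, y)) (de2 (x, y)) (dt2 (x, y))).
  + by apply: (continuous_L2 a0 b0 (c_gw ce1 ct1)) => z /supp[_ h _ h' _];
      rewrite /dpolar_im h h'; ring.
  + by apply: (continuous_L2 a0 b0 (c_gw ce2 ct2)) => z /supp[_ _ h _ h'];
      rewrite /dpolar_im h h'; ring.
(* The modulus is below 2, where [phi] is the identity, so the cutoff is invisible. *)
- have -> : (fun z => phi (Num.sqrt (u z ^+ 2 + w z ^+ 2)) ^+ 2 - 1) = eta.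
    apply/funext => z; rewrite modulus phi_id; last first.
      rewrite sqrtr_ge0/= -[leRHS]ger0_norm// -[leRHS]sqrtr_sqr ler_sqrt ?sqr_ge0//.
      by have := eta_small z; rewrite ler_norml; lra.
    by rewrite -/(rho z) rho2; ring.
  by apply: (continuous_L2 a0 b0 ceta) => z /supp[].
Qed.

(** The momentum density is - rho^2 d_1 theta = - eta d_1 theta - d_1 theta. The first summand is
    integrable; the second is the x_1-derivative of - theta and contributes nothing to L. *)
Lemma polar_momentum (q : R) :
  (\int[@leb2 R]_z (- (eta z * t1 z))%:E = q%:E)%E ->
  momentum_eq u w (gu e1 t1) (gw e1 t1) q.
Proof.
move=> hq; exists (fun z => - (eta z * t1 z)), (fun z => -1 * th z),
  (fun z => -1 * t1 z), (fun z => -1 * t2 z); split; [|split; [|split]] => //.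
- apply: (continuous_L1 a0 b0); first by move=> z; apply: cvgN; exact: continuous_mul.
  by move=> z /supp[-> _ _ _ _];
      rewrite mul0r oppr0.
- split; [|split].
  + apply: C1_weak_grad; exact: continuous_constmul.
  + by apply: (continuous_L2 a0 b0 (continuous_constmul ct1)) => z /supp[_ _ _ -> _];
      rewrite mulr0.
  + by apply: (continuous_L2 a0 b0 (continuous_constmul ct2)) => z /supp[_ _ _ _ ->];
      rewrite mulr0.
- apply: aeW => z.
  have -> : - (eta z * t1 z) + -1 * t1 z = - rho z ^+ 2 * t1 z by rewrite rho2; ring.
  rewrite -[X in - X * _]mulr1 -(cos2Dsin2 (th z)) /polar_re /polar_im /dpolar_re /dpolar_im; ring.
Qed.

Let grad_sq z : gu e1 t1 z ^+ 2 + gu e2 t2 z ^+ 2 + gw e1 t1 z ^+ 2 + gw e2 t2 z ^+ 2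
  = (e1 z ^+ 2 + e2 z ^+ 2) / (4 * (1 + eta z)) + (1 + eta z) * (t1 z ^+ 2 + t2 z ^+ 2).
Proof.
have r0 := lt0r_neq0 (rho_gt0 z); rewrite -rho2.
(* With the factor cos^2 + sin^2 restored, the identity holds for arbitrary values of cos and sin
   and [field] proves it. *)
have -> : (e1 z ^+ 2 + e2 z ^+ 2) / (4 * rho z ^+ 2) + rho z ^+ 2 * (t1 z ^+ 2 + t2 z ^+ 2)
  = (cos (th z) ^+ 2 + sin (th z) ^+ 2) *
    ((e1 z ^+ 2 + e2 z ^+ 2) / (4 * rho z ^+ 2) + rho z ^+ 2 * (t1 z ^+ 2 + t2 z ^+ 2)).
  by rewrite cos2Dsin2 mul1r.
by rewrite /dpolar_re /dpolar_im; field.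
Qed.

(** The kinetic term rho^2 (d_1 theta)^2 equals eta^2 / 2 + eta^3 / 2. Added to eta^2 / 2 - G eta^3
    / 6 from the potential, it yields eta^2 and the cubic coefficient (3 - G) / 6. *)
Lemma polar_energy_le (F : R -> R) (G C : R) :
  (forall z, eta z = - Num.sqrt 2 * t1 z) ->
  (forall z, `|Vpot F (1 + eta z)| <=
    2^-1 * eta z ^+ 2 - G / 6 * eta z ^+ 3 + C * eta z ^+ 4) ->
  (energy F u w (gu e1 t1) (gu e2 t2) (gw e1 t1) (gw e2 t2) <=
   \int[@leb2 R]_z (eta z ^+ 2 + (3 - G) / 6 * eta z ^+ 3 +
    (2^-1 * (e1 z ^+ 2 + e2 z ^+ 2) + 2 * t2 z ^+ 2 + C * eta z ^+ 4))%:E)%E.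
Proof.
move=> eta_t1 hV.
pose W z := 2^-1 * eta z ^+ 2 - G / 6 * eta z ^+ 3 + C * eta z ^+ 4.
(* As |eta| <= 1/2, the weights 1 / (4 rho^2) and rho^2 are at most 1/2 and 2. The weight of
   [t1 z ^+ 2] stays exact, since it feeds the cubic term. *)
pose D z := 2^-1 * (e1 z ^+ 2 + e2 z ^+ 2) + (1 + eta z) * t1 z ^+ 2 + 2 * t2 z ^+ 2.
have W0 z : 0 <= W z by apply: le_trans (hV z).
have gD z : gu e1 t1 z ^+ 2 + gu e2 t2 z ^+ 2 + gw e1 t1 z ^+ 2 + gw e2 t2 z ^+ 2 <= D z.
  rewrite grad_sq /D; have := eta_small z; rewrite ler_norml => /andP[h1 h2].
  have : (e1 z ^+ 2 + e2 z ^+ 2) / (4 * (1 + eta z)) <= 2^-1 * (e1 z ^+ 2 + e2 z ^+ 2).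
    rewrite mulrC ler_wpM2r ?addr_ge0 ?sqr_ge0// lef_pV2 ?posrE//; lra.
  have := sqr_ge0 (t2 z); nra.
have cW : continuous W.
  apply: continuous_add; last by apply: continuous_constmul; exact: continuous_exp.
  by apply: continuous_sub; apply: continuous_constmul; exact: continuous_exp.
have cD : continuous D.
  apply: continuous_add; last by apply: continuous_constmul; exact: continuous_exp.
  apply: continuous_add.
    by apply: continuous_constmul; apply: continuous_add; exact: continuous_exp.
  apply: continuous_mul; last exact: continuous_exp.
  by apply: (@continuous_add _ _ (cst 1)) => // y; exact: cvg_cst.
have iW : L1 W.
  by apply: (continuous_L1 a0 b0 cW) => z /supp[h _ _ _ _];
      rewrite /W h; ring.
have iD : L1 D.
  by apply: (continuous_L1 a0 b0 cD) => z /supp[h h1 h2 h3 h4];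
      rewrite /D h1 h2 h3 h4; ring.
apply: (@le_trans _ _ (\int[@leb2 R]_z (D z)%:E + \int[@leb2 R]_z (W z)%:E)%E).
  apply: leeD; apply: ge0_le_integralT => z; rewrite lee_fin//.
  - by rewrite !addr_ge0// sqr_ge0.
  - by rewrite modulus; exact: hV.
rewrite -(integralD measurableT iD iW); rewrite le_eqVlt; apply/orP; left.
apply/eqP/eq_integral => z _ /=.
rewrite -EFinD; congr EFin; rewrite /D /W.
have : eta z ^+ 2 = 2 * t1 z ^+ 2 by rewrite eta_t1 exprMn sqrrN sqr_sqrtr.
move=> h; have -> : t1 z ^+ 2 = 2^-1 * eta z ^+ 2 by rewrite h; field.
by field.
Qed.

End polar.

(** * The test map *)

Section tensor.
Context {R : realType}.
Local Notation mu := (@lebesgue_measure R).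
Implicit Types (c l m : R) (f g : R -> R).

(** This family is closed under both partial derivatives, which only change the amplitude and one
    profile. Hence theta, eta and all their derivatives in use share the lemmas below. *)
Definition tensor (c l m : R) (f g : R -> R) (z : R * R) : R :=
  c * (f (l * z.1) * g (m * z.2)).

Let continuous_dilate (f : R -> R) (l : R) : continuous f ->
  continuous (fun x => f (l * x)).
Proof.
move=> cf x; apply: (@continuous_comp _ _ _ (fun x => l * x) f); last exact: cf.
exact: mulrl_continuous.
Qed.

Lemma continuous_tensor c l m f g : continuous f -> continuous g ->
  continuous (tensor c l m f g).
Proof.
move=> cf cg; apply: continuous_constmul.
by apply: (@continuous_fstsnd _ (fun x => f (l * x)) (fun y => g (m * y)));
  exact: continuous_dilate.
Qed.

Lemma is_derive_tensor1 c l m f f' g :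
  (forall x : R, is_derive x (1 : R) f (f' x)) -> forall z,
  is_derive z.1 (1 : R) (fun x => tensor c l m f g (x, z.2)) (tensor (c * l) l m f' g z).
Proof.
move=> df z; rewrite /tensor/=.
have := is_derive_constmul (c * g (m * z.2)) (is_derive_dilate (df (l * z.1))).
rewrite (_ : c * g (m * z.2) * (l * f' (l * z.1)) =
  c * l * (f' (l * z.1) * g (m * z.2))); last by ring.
congr is_derive; apply/funext => x; ring.
Qed.

Lemma is_derive_tensor2 c l m f g g' :
  (forall x : R, is_derive x (1 : R) g (g' x)) -> forall z,
  is_derive z.2 (1 : R) (fun y => tensor c l m f g (z.1, y)) (tensor (c * m) l m f g' z).
Proof.
move=> dg z; rewrite /tensor/=.
have := is_derive_constmul (c * f (l * z.1)) (is_derive_dilate (dg (m * z.2))).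
rewrite (_ : c * f (l * z.1) * (m * g' (m * z.2)) =
  c * m * (f (l * z.1) * g' (m * z.2))); last by ring.
congr is_derive; apply/funext => x; ring.
Qed.

Let dilate_itv (l x : R) : 0 < l -> (- l^-1 <= x <= l^-1) = (- 1 <= l * x <= 1).
Proof.
by move=> l0; rewrite -!ler_norml normrM (gtr0_norm l0) mulrC -ler_pdivlMr// div1r.
Qed.

Lemma tensor_out c l m f g : 0 < l -> 0 < m ->
  (forall x, ~~ (- 1 <= x <= 1) -> f x = 0) ->
  (forall x, ~~ (- 1 <= x <= 1) -> g x = 0) ->
  forall z, ~ rect l^-1 m^-1 z -> tensor c l m f g z = 0.
Proof.
move=> l0 m0 f0 g0 z /notin_rect; rewrite !dilate_itv// /tensor.
by case=> [/f0|/g0] ->; ring.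
Qed.

Lemma tensor_bound c l m f g (M : R) : (forall x, `|f x| <= M) ->
  (forall x, `|g x| <= M) -> forall z, `|tensor c l m f g z| <= `|c| * (M * M).
Proof.
move=> fM gM z; rewrite /tensor !normrM; apply: ler_wpM2l => //.
exact: ler_pM.
Qed.

Lemma integral_tensorX n c l m f g (A B : R) : 0 < l -> 0 < m ->
  continuous f -> continuous g ->
  (forall x, ~~ (- 1 <= x <= 1) -> f x = 0) ->
  (forall x, ~~ (- 1 <= x <= 1) -> g x = 0) ->
  (\int[mu]_x (f (l * x) ^+ n.+1)%:E = (A / l)%:E ->
   \int[mu]_x (g (m * x) ^+ n.+1)%:E = (B / m)%:E ->
  \int[@leb2 R]_z (tensor c l m f g z ^+ n.+1)%:E
    = (c ^+ n.+1 * (A / l * (B / m)))%:E)%E.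
Proof.
move=> l0 m0 cf cg f0 g0 hA hB.
have fn0 x : ~~ (- l^-1 <= x <= l^-1) -> f (l * x) ^+ n.+1 = 0.
  by rewrite dilate_itv// => /f0 ->; rewrite expr0n.
have gn0 x : ~~ (- m^-1 <= x <= m^-1) -> g (m * x) ^+ n.+1 = 0.
  by rewrite dilate_itv// => /g0 ->; rewrite expr0n.
have cfn := continuous_exp (n := n.+1) (continuous_dilate (l := l) cf).
have cgn := continuous_exp (n := n.+1) (continuous_dilate (l := m) cg).
have l10 : 0 < l^-1 by rewrite invr_gt0.
have m10 : 0 < m^-1 by rewrite invr_gt0.
have ifg : L1 (fun z : R * R => f (l * z.1) ^+ n.+1 * g (m * z.2) ^+ n.+1).
  apply: (continuous_L1 l10 m10 (continuous_fstsnd cfn cgn)) => z.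
  by move=> /notin_rect[/fn0|/gn0] ->; rewrite ?mul0r ?mulr0.
under eq_integral do rewrite /tensor !exprMn EFinM.
rewrite (integralZl measurableT ifg) EFinM; congr (_ * _)%E.
exact: (integral_fstsnd l10 m10 cfn cgn fn0 gn0 hA hB).
Qed.

End tensor.

Theorem theorem4p15 (R : realType) (F phi : R -> R) :
  cutoff phi -> hypA1 F -> hypA2 F -> hypA4 F -> derive1n 2 F 1 != 3 ->
  forall q : R, 0 < q -> (Emin F phi q < (Num.sqrt 2 * q)%:E)%E.
Proof.
move=> cphi A1 _ A4 G3 q q0.
have [C [d [C0 d0 hV]]] := Vpot_expansion A1 A4.
set G := derive1n 2 F 1 in G3 hV.
pose c3 : R := (3 - G) / 6.
have c30 : c3 != 0 by rewrite mulf_neq0 ?invr_eq0 ?pnatr_eq0// subr_eq0 eq_sym.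
pose s : R := Num.sg c3.
have s2 : s ^+ 2 = 1 by rewrite sqr_sg c30.
have sc3 : c3 * s = `|c3| by rewrite normrEsg mulrC.
have [M [M0 hM]] : exists M : R, 0 < M /\ M = 50 * 50.
  by exists (50 * 50); split => //; rewrite mulr_gt0.
have [I2 I20 hI2] := @integral_prof'_sqr R.
have [J2 J20 hJ2] := @integral_prof2_sqr R.
have [I3 I30 hI3] := @integral_prof'_cube R.
have [J3 J30 hJ3] := @integral_prof2_cube R.
have r0 : 0 < Num.sqrt 2 :> R by rewrite sqrtr_gt0.
have r2 : Num.sqrt 2 ^+ 2 = 2 :> R by rewrite sqr_sqrtr.
have r1 : 1 <= Num.sqrt 2 :> R by rewrite -[leLHS]sqrtr1 ler_sqrt// ler1n.
have r4 : Num.sqrt 2 <= 2 :> R by nra.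
set r : R := Num.sqrt 2 in r0 r1 r2 r4 *.
(* The integral of eta^2 will be 2 t^6 I2 J2 / (l m) = 2 I2 J2 / k; this [k] makes it [r * q],
   independently of [t]. *)
pose k : R := r * I2 * J2 / q.
have k0 : 0 < k by rewrite divr_gt0// !mulr_gt0.
(* [K * t ^+ 10] will bound the remainder: M^2 from d_1 eta, M^2 k^2 from d_2 eta, 2 M^2 k^2 from
   d_2 theta, and 4 C M^4 from the quartic term. *)
pose K : R := M ^+ 2 * (1 + 3 * k ^+ 2) + 4 * C * M ^+ 4.
have K0 : 0 < 4 * K + 1.
  rewrite ltr_wpDl// mulr_ge0// addr_ge0//.
    by rewrite mulr_ge0 ?sqr_ge0// addr_ge0// mulr_ge0 ?sqr_ge0.
  by apply: mulr_ge0; [exact: mulr_ge0|rewrite exprn_ge0// ltW].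
pose X : R := `|c3| * I3 * J3.
have X0 : 0 < X by rewrite !mulr_gt0// normr_gt0.
(* The third condition lets the cubic gain beat the remainder, its summand 1 making the inequality
   strict. The last two put |eta| <= 2 M t in the range of the potential expansion and below 1/2. *)
have [t [t0 t1 tK td tM]] : exists t : R,
    [/\ 0 < t, t <= 1, t * (4 * K + 1) <= X, 2 * M * t < d & 2 * M * t <= 2^-1].
  pose a := Num.min (Num.min 1 (X / (4 * K + 1))) (Num.min (d / (4 * M)) (2^-1 / (2 * M))).
  have M40 : 0 < 4 * M by rewrite mulr_gt0.
  have M20 : 0 < 2 * M by rewrite mulr_gt0.
  have : a <= a by []; rewrite {2}/a !le_min => /andP[/andP[a1 aX] /andP[ad aM]].
  have a_gt0 : 0 < a by rewrite /a !lt_min ltr01 !divr_gt0// invr_gt0.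
  exists a; split => //; first by rewrite -ler_pdivlMr.
    by move: ad; rewrite ler_pdivlMr//; lra.
  by move: aM; rewrite ler_pdivlMr//; lra.
have [l hl] : exists l : R, l = t ^+ 2 by exists (t ^+ 2).
have [m hm] : exists m : R, m = k * t ^+ 4 by exists (k * t ^+ 4).
have l0 : 0 < l by rewrite hl exprn_gt0.
have m0 : 0 < m by rewrite hm mulr_gt0// exprn_gt0.
have l10 : 0 < l^-1 by rewrite invr_gt0.
have m10 : 0 < m^-1 by rewrite invr_gt0.
have [cp cp' cp'' cp2 cp2'] := @continuous_prof R.
pose th := tensor (s * t) l m (@prof R) (@prof2 R).
pose th1 := tensor (s * t * l) l m (@prof' R) (@prof2 R).
pose th2 := tensor (s * t * m) l m (@prof R) (@prof2' R).
pose eta := tensor (- r * (s * t * l)) l m (@prof' R) (@prof2 R).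
pose e1 := tensor (- r * (s * t * l) * l) l m (@prof'' R) (@prof2 R).
pose e2 := tensor (- r * (s * t * l) * m) l m (@prof' R) (@prof2' R).
have ct c f g : continuous f -> continuous g -> continuous (tensor c l m f g).
  exact: continuous_tensor.
have supp z : ~ rect l^-1 m^-1 z ->
    [/\ eta z = 0, e1 z = 0, e2 z = 0, th1 z = 0 & th2 z = 0].
  by move=> zB; split; apply: tensor_out zB => // x /prof_out[].
have bd c (f g : R -> R) : (forall x, `|f x| <= 50) -> (forall x, `|g x| <= 50) ->
    forall z, `|tensor c l m f g z| <= `|c| * M.
  by rewrite hM; exact: tensor_bound.
have bounds z : [/\ `|eta z| <= `|- r * (s * t * l)| * M,
    `|e1 z| <= `|- r * (s * t * l) * l| * M,
    `|e2 z| <= `|- r * (s * t * l) * m| * M & `|th2 z| <= `|s * t * m| * M].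
  by split; apply: bd => x; have [] := prof_bound x.
have s1 : `|s| = 1 by rewrite normr_sg c30.
have tl : t * l <= t by rewrite ger_pMr// hl exprn_ile1// ltW.
have eta_le z : `|eta z| <= 2 * M * t.
  have [+ _ _ _] := bounds z; rewrite !normrM normrN s1 mul1r.
  rewrite (gtr0_norm r0) (gtr0_norm t0) (gtr0_norm l0) => /le_trans; apply.
  have : r * (t * l) <= 2 * t by rewrite ler_pM// ?mulr_ge0// ltW.
  nra.
have eta_half z : `|eta z| <= 2^-1 := le_trans (eta_le z) tM.
have eta_t1 z : eta z = - r * th1 z by rewrite /eta /th1 /tensor; ring.
have out' x : ~~ (- 1 <= x <= 1) -> @prof' R x = 0 by move=> /prof_out[].
have out2 x : ~~ (- 1 <= x <= 1) -> @prof2 R x = 0 by move=> /prof_out[].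
have int_sqr c : (\int[@leb2 R]_z (tensor c l m (@prof' R) (@prof2 R) z ^+ 2)%:E
    = (c ^+ 2 * (I2 / l * (J2 / m)))%:E)%E.
  by apply: integral_tensorX => //; [exact: hI2|exact: hJ2].
have int_cube c : (\int[@leb2 R]_z (tensor c l m (@prof' R) (@prof2 R) z ^+ 3)%:E
    = (c ^+ 3 * (I3 / l * (J3 / m)))%:E)%E.
  by apply: integral_tensorX => //; [exact: hI3|exact: hJ3].
have t_neq0 : t != 0 by rewrite lt0r_neq0.
have q_neq0 : q != 0 by rewrite lt0r_neq0.
have r_neq0 : r != 0 by rewrite lt0r_neq0.
have I2_neq0 : I2 != 0 by rewrite lt0r_neq0.
have J2_neq0 : J2 != 0 by rewrite lt0r_neq0.
have c_eta2 : (- r * (s * t * l)) ^+ 2 = 2 * t ^+ 6.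
  rewrite (_ : _ ^+ 2 = s ^+ 2 * r ^+ 2 * t ^+ 6); first by rewrite s2 r2 mul1r.
  by rewrite hl; ring.
have eta2 : (\int[@leb2 R]_z (eta z ^+ 2)%:E = (r * q)%:E)%E.
  rewrite int_sqr; congr EFin; rewrite c_eta2 -r2 hm /k hl.
  by field; rewrite q_neq0 J2_neq0 I2_neq0 r_neq0 t_neq0.
have ceta := ct (- r * (s * t * l)) _ _ cp' cp2.
have L1_eta n : L1 (fun z => eta z ^+ n.+1).
  apply: (continuous_L1 l10 m10 (continuous_exp ceta)) => z /supp[h _ _ _ _].
  by rewrite [tensor _ _ _ _ _ _]h expr0n.
have eta3 : (\int[@leb2 R]_z (c3 * eta z ^+ 3)%:E =
    (- (2 * r * X * t ^+ 9 * (l^-1 * m^-1)))%:E)%E.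
  under eq_integral do rewrite EFinM.
  rewrite (integralZl measurableT (L1_eta 2)) int_cube -EFinM; congr EFin.
  (* An odd power of the amplitude keeps one factor [- s], and [c3 * s] is the absolute value of
     [c3]. *)
  rewrite exprS c_eta2 /X -sc3 hl; ring.
have hq : (\int[@leb2 R]_z (- (eta z * th1 z))%:E = q%:E)%E.
  transitivity (\int[@leb2 R]_z (r^-1%:E * (eta z ^+ 2)%:E))%E.
    apply: eq_integral => z _; rewrite -EFinM; congr EFin.
    by rewrite eta_t1; field.
  rewrite (integralZl measurableT (L1_eta 1)) eta2 -EFinM; congr EFin.
  by rewrite mulKf.
have ce1 := ct (- r * (s * t * l) * l) _ _ cp'' cp2.
have ce2 := ct (- r * (s * t * l) * m) _ _ cp' cp2'.
have cth := ct (s * t) _ _ cp cp2.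
have ct1 := ct (s * t * l) _ _ cp' cp2.
have ct2 := ct (s * t * m) _ _ cp cp2'.
have de1 := is_derive_tensor1 (- r * (s * t * l)) l m (@prof2 R) (@is_derive_prof' R).
have de2 := is_derive_tensor2 (- r * (s * t * l)) l m (@prof' R) (@is_derive_prof2 R).
have dt1 := is_derive_tensor1 (s * t) l m (@prof2 R) (@is_derive_prof R).
have dt2 := is_derive_tensor2 (s * t) l m (@prof R) (@is_derive_prof2 R).
have hE : in_E phi (polar_re eta th) (polar_im eta th)
    (dpolar_re eta th e1 th1) (dpolar_re eta th e2 th2)
    (dpolar_im eta th e1 th1) (dpolar_im eta th e2 th2).
  exact: (polar_in_E l10 m10).
have hQ : momentum_eq (polar_re eta th) (polar_im eta th)
    (dpolar_re eta th e1 th1) (dpolar_im eta th e1 th1) q.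
  exact: (polar_momentum l10 m10 _ _ _ _ _ _ supp).
pose S z := 2^-1 * (e1 z ^+ 2 + e2 z ^+ 2) + 2 * th2 z ^+ 2 + C * eta z ^+ 4.
have hen : (energy F (polar_re eta th) (polar_im eta th)
    (dpolar_re eta th e1 th1) (dpolar_re eta th e2 th2)
    (dpolar_im eta th e1 th1) (dpolar_im eta th e2 th2) <=
    \int[@leb2 R]_z (eta z ^+ 2 + c3 * eta z ^+ 3 + S z)%:E)%E.
  apply: (polar_energy_le th l10 m10 _ _ _ _ _ supp) => // z.
  exact: hV (le_lt_trans (eta_le z) td).
apply: (@le_lt_trans _ _ (energy F (polar_re eta th) (polar_im eta th)
    (dpolar_re eta th e1 th1) (dpolar_re eta th e2 th2)
    (dpolar_im eta th e1 th1) (dpolar_im eta th e2 th2))).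
  apply: ereal_inf_lbound; exists (polar_re eta th), (polar_im eta th),
    (dpolar_re eta th e1 th1), (dpolar_re eta th e2 th2),
    (dpolar_im eta th e1 th1), (dpolar_im eta th e2 th2).
  by split; [exact: hE|split; [exact: hQ|]].
apply: le_lt_trans hen _.
have sqb (a c : R) : `|a| <= `|c| * M -> a ^+ 2 <= c ^+ 2 * M ^+ 2.
  move=> ac; rewrite -[a ^+ 2]real_normK ?num_real//.
  rewrite -[c ^+ 2]real_normK ?num_real// -exprMn.
  by rewrite lerXn2r ?nnegrE// mulr_ge0// ltW.
(* The functions [e1], [e2], [th2] and [eta] have sizes t^5, t^7, t^5 and t^3, so the four terms
   have orders t^10, t^14, t^10 and t^12; t <= 1 reduces all to t^10. *)
have SK z : S z <= K * t ^+ 10.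
  have [/sqb h0 /sqb h1 /sqb h2 /sqb h3] := bounds z.
  have e1K : e1 z ^+ 2 <= 2 * M ^+ 2 * t ^+ 10.
    apply: le_trans h1 _; rewrite exprMn c_eta2 hl le_eqVlt; apply/orP; left.
    by apply/eqP; ring.
  have tn n : t ^+ n * t ^+ 10 <= t ^+ 10.
    rewrite -[leRHS]mul1r ler_wpM2r ?exprn_ge0 ?exprn_ile1// ltW//.
  have e2K : e2 z ^+ 2 <= 2 * M ^+ 2 * k ^+ 2 * t ^+ 10.
    apply: le_trans h2 _; rewrite exprMn c_eta2 hm.
    rewrite (_ : _ * M ^+ 2 = 2 * M ^+ 2 * k ^+ 2 * (t ^+ 4 * t ^+ 10)); last by ring.
    by rewrite ler_wpM2l// mulr_ge0 ?sqr_ge0// mulr_ge0 ?sqr_ge0.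
  have t2K : th2 z ^+ 2 <= M ^+ 2 * k ^+ 2 * t ^+ 10.
    apply: le_trans h3 _; rewrite hm !exprMn s2 le_eqVlt; apply/orP; left.
    by apply/eqP; ring.
  have etaK : C * eta z ^+ 4 <= 4 * C * M ^+ 4 * t ^+ 10.
    rewrite (_ : 4 * C * _ * _ = C * (4 * M ^+ 4 * t ^+ 10)); last by ring.
    rewrite ler_wpM2l// (exprM _ 2 2).
    apply: (@le_trans _ _ ((2 * t ^+ 6 * M ^+ 2) ^+ 2)).
      by rewrite lerXn2r ?nnegrE ?sqr_ge0 -?c_eta2// mulr_ge0 ?sqr_ge0.
    rewrite (_ : _ ^+ 2 = 4 * M ^+ 4 * (t ^+ 2 * t ^+ 10)); last by ring.
    by rewrite ler_wpM2l// mulr_ge0// exprn_ge0// ltW.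
  by rewrite /S /K; lra.
have cS : continuous S.
  apply: continuous_add; last by apply: continuous_constmul; exact: continuous_exp.
  apply: continuous_add; apply: continuous_constmul; last exact: continuous_exp.
  by apply: continuous_add; exact: continuous_exp.
have S0 z : ~ rect l^-1 m^-1 z -> S z = 0.
  by move=> /supp[h h1 h2 _ h3]; rewrite /S h h1 h2 h3; ring.
have iS : L1 S := continuous_L1 l10 m10 cS S0.
have ic3 : L1 (fun z => c3 * eta z ^+ 3).
  apply: (continuous_L1 l10 m10 (continuous_constmul (continuous_exp ceta))) => z /supp[h _ _ _ _].
  by rewrite [tensor _ _ _ _ _ _]h expr0n mulr0.
have -> : (\int[@leb2 R]_z (eta z ^+ 2 + c3 * eta z ^+ 3 + S z)%:E =
    (r * q)%:E + (- (2 * r * X * t ^+ 9 * (l^-1 * m^-1)))%:E + \int[@leb2 R]_z (S z)%:E)%E.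
  under eq_integral do rewrite !EFinD.
  have i23 := integrableD measurableT (L1_eta 1%N) ic3.
  by rewrite (integralD measurableT i23 iS) (integralD measurableT (L1_eta 1%N) ic3) eta2 eta3.
apply: le_lt_trans (leeD2l _ (integral_le_rect l10 m10 cS S0 SK)) _.
rewrite -!EFinD lte_fin.
have P0 : 0 < t ^+ 9 * (l^-1 * m^-1) by rewrite !mulr_gt0// exprn_gt0.
(* The support has area at most 4 / (l m), whence the 4. After division by the common factor, 4 K t
   < X <= 2 r X remains, by the choice of [t] and r >= 1. *)
have : (4 * K * t) * (t ^+ 9 * (l^-1 * m^-1)) < (2 * r * X) * (t ^+ 9 * (l^-1 * m^-1)).
  rewrite ltr_pM2r//; move: tK t0 X0 r1; clear; nra.
have -> : K * t ^+ 10 * (4 * l^-1 * m^-1) = 4 * K * t * (t ^+ 9 * (l^-1 * m^-1)) by ring.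
rewrite -[2 * r * X * t ^+ 9 * _]mulrA; lra.
Qed.
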